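(* For any $\epsilon>0$, there is a probability kernel $g$ on a binary alphabet $A$ and a shift-invariant probability measure $\mu$ on $A^{\mathbb{Z}}$ compatible with $g$ such that $$\sum_{j=1}^\infty\mathrm{Var}_j(g)^{1+\epsilon}<\infty,\qquad \sum_{j=1}^\infty\mathrm{Var}_j(g)=\infty,$$ and $\mu$ does not satisfy a Gaussian concentration bound (GCB). Moreover, $g$ can be chosen to satisfy $\inf_{x\in\mathcal{X}^-}g(a|x)>0$ for some $a\in A$.
   Context: $A$ is the alphabet with the discrete topology; $A^{\mathbb{Z}}$ has the product topology and the $\sigma$-algebra generated by cylinders; the shift is $(T\omega)_i=\omega_{i+1}$. For integers $i\le j$, $\omega_i^j=(\omega_i,\dots,\omega_j)$ (the empty string if $i>j$). $\mathcal{X}^-=A^{\{\dots,-2,-1\}}$. A probability kernel is a function $g:A\times\mathcal{X}^-\to[0,1]$ with $\sum_{s\in A}g(s|x)=1$ for all $x\in\mathcal{X}^-$; for a left-infinite sequence ending at another index $n-1$, $g(\cdot|\cdot)$ denotes the same function after re-indexing. A probability measure $\mu$ on $A^{\mathbb{Z}}$ is compatible with $g$ if for all $n\in\mathbb{Z}$, $a\in A$, and $\mu$-a.e. past $x=(\dots,x_{n-2},x_{n-1})$, the conditional probability under $\mu$ that the $n$-th coordinate equals $a$ given the $\sigma$-algebra generated by coordinates up to $n-1$ is $g(a|x)$. For $j\ge1$, $\mathrm{Var}_j(g)=\sup\{\frac12\sum_{a\in A}|g(a|z)-g(a|z')|: z,z'\in\mathcal{X}^-,\ z_k=z'_k\ \forall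 k\ge -j\}$. For $f:A^{n+1}\to\mathbb{R}$ and $0\le j\le n$, $\delta_j(f)=\sup\{|f(\omega_0^{j-1}a\,\omega_{j+1}^n)-f(\omega_0^{j-1}b\,\omega_{j+1}^n)|: a,b\in A,\ \omega\in A^{n+1}\}$. $\mathcal{L}=\bigcup_{n\ge0}\{f:A^{n+1}\to\mathbb{R}: \delta_j(f)<\infty,\ j=0,\dots,n\}$; such $f$ is viewed as a function of coordinates $0,\dots,n$, and $\|\underline{\delta}(f)\|_2^2=\sum_{j=0}^n\delta_j(f)^2$. A probability measure $\mu$ satisfies a Gaussian concentration bound (GCB) if there is a constant $C>0$ such that for all $f\in\mathcal{L}$, $\mathbb{E}_\mu[e^{f-\mathbb{E}_\mu[f]}]\le e^{C\|\underline{\delta}(f)\|_2^2}$ ($C$ independent of $f$ and $n$). *)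

(* Defs.v *)
From HB Require Import structures.
From mathcomp Require Import all_boot all_order all_algebra.
From mathcomp Require Import all_classical all_reals all_analysis.

Set Implicit Arguments.
Unset Strict Implicit.
Unset Printing Implicit Defensive.

Import Order.TTheory GRing.Theory Num.Theory.
Import numFieldNormedType.Exports.

Local Open Scope classical_set_scope.
Local Open Scope ring_scope.

(* The binary alphabet is bool. One-coordinate cylinders generate the same
   sigma-algebra on bool^Z as all finite cylinders. *)
Definition cylinders : set (set (int -> bool)) :=
  [set E | exists (i : int) (a : bool), E = [set w | w i = a]].

Notation conf := (g_sigma_algebraType cylinders).

Definition shift (w : conf) : conf := fun i : int => w (i + 1).

Definition shift_invariant (R : realType) (mu : probability conf R) : Prop :=
  forall B : set conf, measurable B -> mu (shift @^-1` B) = mu B.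

(* A left-infinite sequence ..., x_{-2}, x_{-1} is encoded as the function
   k |-> x_{-(k+1)} on nat. *)
Definition past := nat -> bool.

(* The sequence ..., w_{n-2}, w_{n-1}, re-indexed to end at index -1. *)
Definition past_before (n : int) (w : conf) : past :=
  fun k : nat => w (n - k.+1%:Z).

Definition is_kernel (R : realType) (g : bool -> past -> R) : Prop :=
  (forall (s : bool) (x : past), 0 <= g s x <= 1) /\
  (forall x : past, \sum_(s : bool) g s x = 1).

(* Generators of the sigma-algebra of the coordinates up to n - 1. *)
Definition past_cylinders (n : int) : set (set conf) :=
  [set E | exists (i : int) (a : bool), i <= n - 1 /\ E = [set w | w i = a]].

(* h is a version of the conditional probability of B under mu, given the
   sigma-algebra generated by G (of interest when G consists of measurable
   sets). *)
Definition is_cond_prob (R : realType) (mu : probability conf R)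
    (G : set (set conf)) (B : set conf) (h : conf -> R) : Prop :=
  [/\ measurable_fun [set: g_sigma_algebraType G]
        (h : g_sigma_algebraType G -> R),
      mu.-integrable [set: conf] (EFin \o h)
    & forall E : set conf, G.-sigma.-measurable E ->
        (\int[mu]_(w in E) (h w)%:E)%E = mu (E `&` B)].

Definition compatible (R : realType) (mu : probability conf R)
    (g : bool -> past -> R) : Prop :=
  forall (n : int) (a : bool),
    exists2 h : conf -> R,
      is_cond_prob mu (past_cylinders n) [set w : conf | w n = a] h
    & {ae mu, forall w, h w = g a (past_before n w)}.

(* Index i : nat of a past stands for -(i+1), so -(i+1) >= -j means i < j.
   The supremum is over a nonempty set, bounded above when g is a kernel. *)
Definition Var (R : realType) (g : bool -> past -> R) (j : nat) : R :=
  sup [set r : R | exists z z' : past,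
    (forall i : nat, (i < j)%N -> z i = z' i) /\
    r = 2^-1 * \sum_(a : bool) `|g a z - g a z'| ].

Definition subst_at (n : nat) (w : {ffun 'I_n.+1 -> bool}) (j : 'I_n.+1)
    (a : bool) : {ffun 'I_n.+1 -> bool} :=
  [ffun i => if i == j then a else w i].

Definition delta (R : realType) (n : nat) (f : {ffun 'I_n.+1 -> bool} -> R)
    (j : 'I_n.+1) : \bar R :=
  ereal_sup [set r : \bar R |
    exists (a b : bool) (w : {ffun 'I_n.+1 -> bool}),
      r = `|f (subst_at w j a) - f (subst_at w j b)|%:E].

Definition in_L (R : realType) (n : nat)
    (f : {ffun 'I_n.+1 -> bool} -> R) : Prop :=
  forall j : 'I_n.+1, (delta f j < +oo)%E.

Definition delta_norm2_sq (R : realType) (n : nat)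
    (f : {ffun 'I_n.+1 -> bool} -> R) : R :=
  \sum_(j < n.+1) (fine (delta f j)) ^+ 2.

Definition on_conf (R : realType) (n : nat)
    (f : {ffun 'I_n.+1 -> bool} -> R) (w : conf) : R :=
  f [ffun i : 'I_n.+1 => w (i : nat)%:Z].

Definition GCB (R : realType) (mu : probability conf R) : Prop :=
  exists C : R, 0 < C /\
    forall (n : nat) (f : {ffun 'I_n.+1 -> bool} -> R), in_L f ->
      ('E_mu[ (fun w => expR (on_conf f w - fine 'E_mu[on_conf f])) ]
        <= (expR (C * delta_norm2_sq f))%:E)%E.

(* Main.v *)
(* The process is a stationary renewal process on Z: a symbol [true] comes after
   k symbols [false] with probability q_k = 2/(k+3), and with probability 0 when
   the whole past is [false]. Hence Var_j = q_j, whose sum diverges while the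
   sum of its (1+eps)-th powers converges, and [false] always has probability at
   least 1/3. The gaps have tail 2/((k+1)(k+2)) and mean 2, so that the word of
   n symbols [false] has the polynomial probability 1/(n+1). A Gaussian
   concentration bound for the number of [false] among n symbols, whose mean is
   n/2, would make it exponentially small.
   The measure is the image of Lebesgue measure on [0,1[ under the coding by
   nested intervals whose lengths are the prescribed word probabilities. *)
Require Import Defs.
From HB Require Import structures.
From mathcomp Require Import all_boot all_order all_algebra.
From mathcomp Require Import all_classical all_reals all_analysis.
From mathcomp Require Import measurable_realfun.
From mathcomp Require Import ring lra zify.

Set Implicit Arguments.
Unset Strict Implicit.
Unset Printing Implicit Defensive.

Import Order.TTheory GRing.Theory Num.Theory.
Import numFieldNormedType.Exports.

Local Open Scope classical_set_scope.
Local Open Scope ring_scope.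

Lemma rcons_nseq (T : Type) n (x : T) : rcons (nseq n x) x = nseq n.+1 x.
Proof. by elim: n => //= n ->. Qed.

(** * Word probabilities of the renewal process *)

Section weights.
Variable R : realType.

(** Conditional probability of the next symbol [b] given the recent symbols [v]. When [v] has n
    symbols and no [true], the age of the last renewal is unknown; the value 1/(n+2) is the one that
    gives words of [false] the weights 1/(n+1). *)
Definition rate (b : bool) (v : seq bool) : R :=
  let r := if has id v then 2 / (find id v).+3%:R else (size v).+2%:R^-1 in
  if b then r else 1 - r.

(* Words list the most recent symbol first, as [past] does. *)
Fixpoint weight (v : seq bool) : R :=
  if v is b :: v' then weight v' * rate b v' else 1.

Lemma rate_ge0 b v : 0 <= rate b v.
Proof.
rewrite /rate; case: b; case: ifP => _; rewrite ?subr_ge0 ?divr_ge0//.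
- by rewrite ler_pdivrMr// mul1r ler_nat.
- by rewrite invf_le1// ler1n.
Qed.

Lemma weight_ge0 v : 0 <= weight v.
Proof. by elim: v => //= b v IH; rewrite mulr_ge0// rate_ge0. Qed.

Lemma weight_cons v : weight (true :: v) + weight (false :: v) = weight v.
Proof. by rewrite /= /rate; ring. Qed.

Lemma rate_rcons b c v : has id v -> rate b (rcons v c) = rate b v.
Proof.
by move=> hv; rewrite /rate -cats1 find_cat has_cat hv.
Qed.

Lemma weight_nseq n : weight (nseq n false) = n.+1%:R^-1.
Proof.
elim: n => [|n IH] /=; first by rewrite invr1.
have n0 : n%:R >= 0 :> R by [].
by rewrite IH /rate has_nseq andbF size_nseq !mulrS; field; lra.
Qed.

Lemma seq_false v : ~~ has id v -> v = nseq (size v) false.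
Proof. by elim: v => [|[] v IH] //= /IH <-. Qed.

(** Each further [false] multiplies the weight by 1 - 2/(n+3) = (n+1)/(n+3). The value equals
    1/(n+1) - 1/(n+2), which is what consistency towards the past requires of words of [false]. *)
Lemma weight_rcons_true n :
  weight (rcons (nseq n false) true) = (n.+1%:R * n.+2%:R)^-1.
Proof.
elim: n => [|n IH] /=.
  by rewrite /rate/=; field.
rewrite IH /rate has_rcons/= -cats1 find_cat has_nseq andbF size_nseq/= addn0.
have n0 : n%:R >= 0 :> R by [].
by rewrite !mulrS; field; lra.
Qed.

(* The one-step rates depend only on the distance to the last [true] once there
   is one, so only words of [false] have to be checked. *)
Lemma weight_rcons v :
  weight (rcons v true) + weight (rcons v false) = weight v.
Proof.
elim: v => [|b v IH]; first by rewrite /= /rate/=; field.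
have [hv|hv] := boolP (has id v).
  by rewrite /= !rate_rcons// -mulrDl IH.
have wt c : weight (rcons (c :: v) true) + weight (rcons (c :: v) false) =
    weight v * rate c v.
  rewrite (seq_false hv); set n := size v.
  have n0 : n%:R >= 0 :> R by [].
  rewrite /= rcons_nseq weight_rcons_true !weight_nseq /rate.
  rewrite has_rcons/= -cats1 find_cat !has_nseq !andbF !size_nseq/= addn0.
  by rewrite !mulrS; case: c; field; lra.
exact: wt.
Qed.

End weights.

(** * Stationary measures from consistent word probabilities *)

Lemma measurable_cyl1 (i : int) (a : bool) :
  measurable ([set w | w i = a] : set conf).
Proof. by apply: sub_sigma_algebra; exists i, a. Qed.

(** Words are read backwards from site n-1: [rcons] extends a cylinder into the past, while [cons]
    moves its end one site forward. *)
Definition cyl (n : int) (v : seq bool) : set conf :=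
  [set w | mkseq (past_before n w) (size v) = v].

Lemma cyl_nil n : cyl n [::] = setT.
Proof. exact/seteqP. Qed.

Lemma cyl_rcons n v b :
  cyl n (rcons v b) = cyl n v `&` [set w | w (n - (size v).+1%:Z) = b].
Proof.
rewrite /cyl size_rcons; apply/seteqP; split=> w /=; rewrite mkseqS.
  by move/rcons_inj => [-> <-].
by case=> -> <-.
Qed.

Lemma mkseq_past_before_succ n w m :
  mkseq (past_before (n + 1) w) m.+1 = w n :: mkseq (past_before n w) m.
Proof.
rewrite /mkseq /= -[1%N]addn0 iotaDl -map_comp; congr cons.
  by rewrite /past_before addrK.
apply: eq_map => k /=; rewrite /past_before; congr w.
by rewrite add1n (intS k.+1) opprD addrA addrK.
Qed.

Lemma cyl_cons n v b : cyl (n + 1) (b :: v) = cyl n v `&` [set w | w n = b].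
Proof.
rewrite /cyl; apply/seteqP; split=> w /=; rewrite mkseq_past_before_succ.
  by case=> -> ->.
by case=> -> ->.
Qed.

Lemma measurable_cyl n v : measurable (cyl n v).
Proof.
elim/last_ind: v => [|v b IH]; first by rewrite cyl_nil.
by rewrite cyl_rcons; apply: measurableI => //; exact: measurable_cyl1.
Qed.

Lemma measure_split (R : realType) (m : {measure set conf -> \bar R})
    (E : set conf) (i : int) : measurable E ->
  m E = (m (E `&` [set w | w i = true]) + m (E `&` [set w | w i = false]))%E.
Proof.
move=> mE; rewrite -measureU ?setIUr//.
- rewrite -setIUr; congr (m _); apply/seteqP; split=> w /=; last by case.
  by case: (w i); split=> //; [left|right].
- by apply: measurableI => //; exact: measurable_cyl1.
- by apply: measurableI => //; exact: measurable_cyl1.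
- by apply/seteqP; split=> w //= [[_ ->] [_]].
Qed.

Section unif01.
Variable R : realType.

Definition unif01 :=
  mrestr (@lebesgue_measure R) (measurable_itv `[0 : R, 1[).

HB.instance Definition _ := Measure.on unif01.

Lemma unif01_setT : unif01 setT = 1%E.
Proof.
by rewrite /unif01 /mrestr setTI lebesgue_measure_itv/= lte_fin ltr01 oppr0 adde0.
Qed.

HB.instance Definition _ := Measure_isProbability.Build _ _ _ unif01 unif01_setT.

End unif01.

(** * Coding of [0,1[ by nested intervals of prescribed lengths *)

Section interval_coding.
Variables (R : realType) (q : seq bool -> R).
Hypothesis q_ge0 : forall t, 0 <= q t.
Hypothesis q_nil : q [::] = 1.
Hypothesis q_cons : forall t, q (true :: t) + q (false :: t) = q t.

(** The interval of a word [t] has length [q t]; it is cut into a left piece for the digit [false]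
    and a right piece for [true]. The latest digit comes first. *)
Fixpoint left_end (t : seq bool) : R :=
  if t is b :: t' then left_end t' + (if b then q (false :: t') else 0) else 0.

Fixpoint digits (u : R) (n : nat) : seq bool :=
  if n is m.+1 then
    let t := digits u m in (left_end t + q (false :: t) <= u) :: t
  else [::].

Lemma size_digits u n : size (digits u n) = n.
Proof. by elim: n => //= n ->. Qed.

(** By [q_cons] the two pieces tile the interval of [t], and the comparison in [digits] selects the
    piece containing [u]; induction on the word. *)
Lemma digitsP t : [set u | digits u (size t) = t] `&` `[0, 1[%classic =
  `[left_end t, left_end t + q t[%classic.
Proof.
elim: t => [|b t IH]; first by rewrite /= q_nil add0r; apply/seteqP; split=> u [].
have qt0 := q_ge0 (true :: t); have qf0 := q_ge0 (false :: t).
have qE := q_cons t.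
apply/seteqP; split => u /=.
  case=> -[<- ut] u01.
  have : (`[left_end t, left_end t + q t[%classic u) by rewrite -IH.
  rewrite ut /= !in_itv/=.
  case: (lerP (left_end t + q (false :: t))) => ? /andP[? ?];
    by apply/andP; split; lra.
rewrite in_itv/= => ub.
have : (`[left_end t, left_end t + q t[%classic u).
  by rewrite /= in_itv/=; case: b ub => /andP[? ?]; apply/andP; split; lra.
rewrite -IH => -[/= ut u01]; split => //; congr cons => //.
rewrite ut; move: ub; clear IH.
by case: (lerP (left_end t + q (false :: t))); case: (b) => // ? /andP[? ?]; lra.
Qed.

Lemma measurable_digits n t : measurable [set u | digits u n = t].
Proof.
elim: n t => [|n IH] [|b t] /=.
- by rewrite (_ : [set _ | _] = setT)//; apply/seteqP; split.
- by rewrite (_ : [set _ | _] = set0)//; apply/seteqP; split=> u.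
- by rewrite (_ : [set _ | _] = set0)//; apply/seteqP; split=> u.
rewrite (_ : [set _ | _] = [set u | digits u n = t] `&`
    (if b then `[left_end t + q (false :: t), +oo[%classic
     else `]-oo, left_end t + q (false :: t)[%classic)); last first.
  apply/seteqP; split=> u /=.
    by case=> <- ->; split => //; case: lerP => /=; rewrite in_itv/= ?andbT.
  by case=> ->; case: b; rewrite /= in_itv/= ?andbT => h; rewrite ?h// leNgt h.
by apply: measurableI => //; case: (b); exact: measurable_itv.
Qed.

Lemma unif01_digits t : unif01 [set u | digits u (size t) = t] = (q t)%:E.
Proof.
rewrite /unif01 /mrestr digitsP lebesgue_measure_itv/= lte_fin.
(* The second case is an empty interval, where [q t] is 0. *)
rewrite ltrDl; case: ltP => [_|q0]; first by rewrite -EFinB addrC addKr.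
by congr EFin; apply/le_anti/andP.
Qed.

End interval_coding.

(** * Measures determined by their values on cylinders *)

Section pi_lambda.
Variables (R : realType) (m1 m2 : {measure set conf -> \bar R}).
Hypothesis m1_fin : (m1 setT < +oo)%E.

Lemma sub_cyl (n : int) (w : conf) (v v' : seq bool) :
  (size v <= size v')%N -> cyl n v w -> cyl n v' w -> cyl n v' `<=` cyl n v.
Proof.
move=> vv' <- <- w'; rewrite /cyl /= !size_mkseq => e.
have := congr1 (take (size v)) e; rewrite /mkseq -!map_take !take_iota.
by rewrite (minn_idPl vv').
Qed.

(** Two cylinders ending at the same site are disjoint or nested. *)
Lemma setI_closed_cyl n : setI_closed (range (cyl n) `|` [set set0]).
Proof.
move=> A B [[v _ <-]|->] [[v' _ <-]|->]; rewrite ?setI0 ?set0I; try by right.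
have [->|/set0P[w [wv wv']]] := eqVneq (cyl n v `&` cyl n v') set0; first by right.
left; have [vv'|/ltnW v'v] := leqP (size v) (size v').
  by exists v' => //; rewrite setIidr//; exact: sub_cyl wv wv'.
by exists v => //; rewrite setIidl//; exact: sub_cyl wv' wv.
Qed.

Lemma past_cylinders_cyl n :
  past_cylinders n `<=` <<s range (cyl n) `|` [set set0] >>.
Proof.
move=> _ [i [a [ni ->]]].
have [k ->] : exists k : nat, i = n - k.+1%:Z.
  exists (absz (n - 1 - i)%R); rewrite intS gez0_abs ?subr_ge0//; ring.
pose G := range (cyl n) `|` [set set0].
(* Here [j] counts the sites still unspecified between the word [v] and the site of interest; each
   induction step splits on the nearest of them. *)
suff H j v : (size v + j = k)%N ->
    <<s G >> (cyl n v `&` [set w | w (n - k.+1%:Z) = a]).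
  by have := H k [::] erefl; rewrite cyl_nil setTI.
elim: j v => [|j IH] v; rewrite ?addn0 => vk.
  by rewrite -vk -cyl_rcons; apply: sub_sigma_algebra; left; exists (rcons v a).
rewrite (_ : _ `&` _ =
    (cyl n (rcons v true) `&` [set w | w (n - k.+1%:Z) = a]) `|`
    (cyl n (rcons v false) `&` [set w | w (n - k.+1%:Z) = a])); last first.
  rewrite !cyl_rcons; apply/seteqP; split=> w /=; last by tauto.
  by case: (w (n - (size v).+1%:Z)); tauto.
by apply: (@measurableU _ (g_sigma_algebraType G)); apply: IH;
  rewrite size_rcons addSnnS.
Qed.

Lemma eq_measure_past n : (forall v, m1 (cyl n v) = m2 (cyl n v)) ->
  forall E, <<s past_cylinders n >> E -> m1 E = m2 E.
Proof.
move=> m12 E nE; pose G := range (cyl n) `|` [set set0].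
apply: (g_sigma_algebra_measure_unique G _ (fun=> cyl n [::])).
- by move=> _ [[v _ <-]|->]; [exact: measurable_cyl|].
- by move=> _; left; exists [::].
- by rewrite cyl_nil bigcup_const//; exists 0%N.
- exact: setI_closed_cyl.
- by move=> _ [[v _ <-]|->]; [exact: m12|rewrite !measure0].
- by move=> _; rewrite cyl_nil.
- apply: smallest_sub nE; last exact: past_cylinders_cyl.
  exact: smallest_sigma_algebra.
Qed.

(** Cylinders with different end sites may overlap without being nested, so the pi-system taken here
    is the union of the increasing sigma-algebras of the pasts, on each of which [eq_measure_past]
    applies. *)
Lemma eq_measure_cyl : (forall n v, m1 (cyl n v) = m2 (cyl n v)) ->
  forall E, measurable E -> m1 E = m2 E.
Proof.
move=> m12 E mE.
pose G := \bigcup_n <<s past_cylinders n >>.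
have pm n : past_cylinders n `<=` measurable.
  by move=> _ [i [a [_ ->]]]; exact: measurable_cyl1.
apply: (g_sigma_algebra_measure_unique G _ (fun=> setT)).
- move=> A [n _ nA]; apply: smallest_sub nA; last exact: pm.
  exact: sigma_algebra_measurable.
- by move=> _; exists 0 => //; exact: (@measurableT _ (g_sigma_algebraType _)).
- by rewrite bigcup_const//; exists 0%N.
- move=> A B [n _ nA] [n' _ nB]; exists (Num.max n n') => //.
  have mono k k' : k <= k' -> <<s past_cylinders k >> `<=` <<s past_cylinders k' >>.
    move=> kk'; apply: sub_smallest2r; first exact: smallest_sigma_algebra.
    move=> _ [i [a [ik ->]]]; exists i, a; split=> //.
    by rewrite (le_trans ik)// lerB.
  by apply: (@measurableI _ (g_sigma_algebraType (past_cylinders (Num.max n n'))));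
    [move: nA|move: nB]; apply: mono; rewrite le_max lexx ?orbT.
- by move=> A [n _]; apply: eq_measure_past => v; exact: m12.
- by [].
- apply: smallest_sub mE; first exact: smallest_sigma_algebra.
  move=> _ [i [a ->]]; apply: sub_sigma_algebra; exists (i + 1) => //.
  by apply: sub_sigma_algebra; exists i, a; rewrite addrK.
Qed.

End pi_lambda.

(** * Construction of a stationary law from consistent word probabilities *)

Section stationary_extension.
Variables (R : realType) (p : seq bool -> R).
Hypothesis p_ge0 : forall v, 0 <= p v.
Hypothesis p_nil : p [::] = 1.
Hypothesis p_cons : forall v, p (true :: v) + p (false :: v) = p v.
Hypothesis p_rcons : forall v, p (rcons v true) + p (rcons v false) = p v.

(* The digits of a code are placed at the sites 0, -1, 1, -2, 2, ...; [unfold]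
   lists them by decreasing site. *)
Fixpoint unfold (t : seq bool) : seq bool :=
  if t is b :: t' then
    if odd (size t') then rcons (unfold t') b else b :: unfold t'
  else [::].

Lemma size_unfold t : size (unfold t) = size t.
Proof. by elim: t => //= b t IH; case: odd; rewrite ?size_rcons /= IH. Qed.

Lemma unfold_inj t t' : size t = size t' -> unfold t = unfold t' -> t = t'.
Proof.
elim: t t' => [|b t IH] [|b' t'] //= [tt']; rewrite tt'; case: odd.
  by move=> /rcons_inj [/(IH _ tt') -> ->].
by case=> -> /(IH _ tt') ->.
Qed.

Lemma unfold_surj v : exists t, size t = size v /\ unfold t = v.
Proof.
move sv : (size v) => n; elim: n v sv => [|n IH] v.
  by move/size0nil ->; exists [::].
have [n1|n0] := boolP (odd n).
  case/lastP: v => // v b; rewrite size_rcons => -[/IH [t [tn tv]]].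
  by exists (b :: t); rewrite /= tn n1 tv.
case: v => // b v [/IH [t [tn tv]]].
by exists (b :: t); rewrite /= tn (negbTE n0) tv.
Qed.

Let q t := p (unfold t).

Let q_ge0 t : 0 <= q t. Proof. exact: p_ge0. Qed.

(** A new digit lands at the past end of the window when the length is odd and at its future end
    otherwise, so the two consistency conditions are used in turn. *)
Let q_cons t : q (true :: t) + q (false :: t) = q t.
Proof. by rewrite /q /=; case: odd; rewrite ?p_rcons ?p_cons. Qed.

(** Since [digits] lists the latest digit first, [head] of the first m+1 digits is digit number m,
    counted from 0. *)
Definition sample (u : measurableTypeR R) : conf := fun i =>
  match i with
  | Posz k => head false (digits q u k.*2.+1)
  | Negz k => head false (digits q u k.*2.+2)
  end.

Lemma measurable_sample : measurable_fun setT sample.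
Proof.
apply: (@measurability _ _ _ conf _ _ cylinders) => //.
move=> _ [_ [i [a ->]] <-]; rewrite setTI.
have H n b : measurable [set u : R | head false (digits q u n.+1) = b].
  rewrite (_ : [set _ | _] = \bigcup_t [set u | digits q u n.+1 = b :: t]).
    apply: countable_bigcupT_measurable; first exact: countableP.
    by move=> t; exact: measurable_digits.
  apply/seteqP; split=> u /=; last by case=> t _ [->].
  by move=> h; exists (digits q u n) => //=; rewrite h.
by case: i => k; exact: H.
Qed.

(** The first 2k digits fill exactly the window of sites -k, ..., k-1. *)
Lemma mkseq_sample k u :
  mkseq (past_before k%:Z (sample u)) k.*2 = unfold (digits q u k.*2).
Proof.
elim: k => // k IH.
rewrite doubleS -addn1 PoszD mkseq_past_before_succ mkseqS IH /=.
rewrite size_digits odd_double /=; congr (_ :: rcons _ _).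
by rewrite /past_before (_ : _ - _ = Negz k) // NegzE -addnn; lia.
Qed.

HB.instance Definition _ := isMeasurableFun.Build _ _ _ _ _ measurable_sample.

Definition stationary_law : probability conf R :=
  distribution (@unif01 R) sample.

Lemma stationary_law_sym k v : size v = k.*2 ->
  stationary_law (cyl k%:Z v) = (p v)%:E.
Proof.
move=> vk; have [t [tv <-]] := unfold_surj v.
rewrite -(@unif01_digits _ q)//; congr (unif01 _).
apply/seteqP; split=> u; rewrite /cyl /= size_unfold tv vk mkseq_sample.
  by move=> /unfold_inj; apply; rewrite size_digits tv vk.
by move=> ->.
Qed.

Lemma stationary_law_cyl n v : stationary_law (cyl n v) = (p v)%:E.
Proof.
(* A window ending at k-1 is prolonged into the past, by [p_rcons], until it is symmetric. *)
have H1 k d w : (size w + d = k.*2)%N ->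
    stationary_law (cyl k%:Z w) = (p w)%:E.
  elim: d w => [|d IH] w; first by rewrite addn0; exact: stationary_law_sym.
  rewrite addnS -addSn => wd.
  rewrite (measure_split _ (k%:Z - (size w).+1%:Z) (measurable_cyl _ _)).
  rewrite -!cyl_rcons -p_rcons EFinD.
  by congr (_ + _)%E; apply: IH; rewrite size_rcons.
(* A window ending before k-1 is prolonged into the future, by [p_cons], until it ends there. *)
have H2 k c w : (c + size w <= k.*2)%N ->
    stationary_law (cyl (k%:Z - c%:Z) w) = (p w)%:E.
  elim: c w => [|c IH] w wk.
    by rewrite subr0; apply: (H1 _ (k.*2 - size w)%N); rewrite subnKC.
  rewrite (measure_split _ (k%:Z - c.+1%:Z) (measurable_cyl _ _)).
  rewrite -!cyl_cons (_ : k%:Z - c.+1%:Z + 1 = k%:Z - c%:Z); last first.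
    by rewrite intS; ring.
  rewrite -p_cons EFinD.
  by congr (_ + _)%E; apply: IH; rewrite /= addnS -addSn.
(* The choice k = |n| + [size v] makes the symmetric window contain the given one. *)
have [c cE] : exists c : nat, (`|n| + size v)%:Z - n = c%:Z.
  by exists (absz ((`|n| + size v)%:Z - n)); lia.
rewrite (_ : n = (`|n| + size v)%:Z - c%:Z); last by rewrite -cE; ring.
by apply: H2; lia.
Qed.

Lemma shift_cyl n v : Defs.shift @^-1` cyl n v = cyl (n + 1) v.
Proof.
apply/seteqP; split=> w; rewrite /cyl /= => <-; rewrite !size_mkseq;
  apply: eq_mkseq => k; rewrite /past_before /Defs.shift; congr w; ring.
Qed.

Lemma measurable_shift : measurable_fun setT Defs.shift.
Proof.
apply: (@measurability _ _ _ conf _ _ cylinders) => //.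
move=> _ [_ [i [a ->]] <-]; rewrite setTI.
exact: measurable_cyl1 (i + 1) a.
Qed.

HB.instance Definition _ := isMeasurableFun.Build _ _ _ _ _ measurable_shift.

Lemma stationary_law_shift : shift_invariant stationary_law.
Proof.
apply: (@eq_measure_cyl _ (distribution stationary_law Defs.shift)) => [|n v].
  by rewrite ltey_eq fin_num_measure.
rewrite /distribution /pushforward /= shift_cyl.
by transitivity (p v)%:E; [|symmetry]; exact: stationary_law_cyl.
Qed.

End stationary_extension.

(** * The renewal kernel and its variation *)

Section kernel.
Variable R : realType.

(** Hazard rate of the gap law: with tail G(k) = 2/((k+1)(k+2)), the value 2/(k+3) is 1 -
    G(k+1)/G(k). The value 0 on the past without [true] is its limit. *)
Definition hazard (x : past) : R :=
  if pselect (exists k, x k) is left e then 2 / (ex_minn e).+3%:R else 0.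

Definition kern (a : bool) (x : past) : R :=
  if a then hazard x else 1 - hazard x.

Lemma hazard_first (x : past) k :
  x k -> (forall i, (i < k)%N -> ~~ x i) -> hazard x = 2 / k.+3%:R.
Proof.
move=> xk xN; rewrite /hazard; case: pselect => [e|]; last by case; exists k.
case: ex_minnP => m xm m_min; rewrite (_ : m = k)//.
apply/eqP; rewrite eqn_leq m_min//= leqNgt; apply/negP => /xN.
by rewrite xm.
Qed.

Lemma hazard_none (x : past) : (forall k, ~~ x k) -> hazard x = 0.
Proof.
move=> xN; rewrite /hazard; case: pselect => // e.
by have [k xk] := e; have := xN k; rewrite xk.
Qed.

Lemma kern_mkseq a (x : past) m :
  has id (mkseq x m) -> kern a x = rate R a (mkseq x m).
Proof.
move=> hx; suff hE : hazard x = 2 / (find id (mkseq x m)).+3%:R.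
  by rewrite /kern /rate hx hE.
have fm : (find id (mkseq x m) < m)%N.
  by rewrite -[X in (_ < X)%N](size_mkseq x) -has_find.
apply: hazard_first => [|i im].
  by have := nth_find false hx; rewrite nth_mkseq.
have := before_find false im; rewrite nth_mkseq ?(ltn_trans im)// => ->.
by [].
Qed.

Lemma hazard_bounds (x : past) m : (forall i, (i < m)%N -> ~~ x i) ->
  0 <= hazard x <= 2 / m.+3%:R.
Proof.
move=> xm; rewrite /hazard; case: pselect => [e|_]; last first.
  by rewrite lexx divr_ge0.
case: ex_minnP => k xk _; rewrite divr_ge0//= ler_pM2l// lef_pV2 ?posrE//.
by rewrite ler_nat !ltnS leqNgt; apply: contraL xk; exact: xm.
Qed.

Lemma hazard_le x : 0 <= hazard x <= 2 / 3.
Proof. by apply: (@hazard_bounds x 0). Qed.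

Lemma kern_bounds a x : 0 <= kern a x <= 1.
Proof.
have /andP[? ?] := hazard_le x.
by rewrite /kern; case: a; apply/andP; split; lra.
Qed.

Lemma is_kernel_kern : is_kernel kern.
Proof.
split=> [s x|x]; first exact: kern_bounds.
by rewrite big_bool /= subrKC.
Qed.

Lemma inf_kern_false : 0 < inf [set kern false x | x in [set: past]].
Proof.
apply: (@lt_le_trans _ _ (1 / 3)) => //.
apply: lb_le_inf; first by exists (kern false (fun=> true)); exists (fun=> true).
by move=> _ [x _ <-]; rewrite /kern; have := hazard_le x; lra.
Qed.

(** Pasts that agree on j symbols have equal hazards if a [true] is among these; otherwise both
    hazards lie between 0 and 2/(j+3). *)
Lemma Var_kern j : Var kern j = 2 / j.+3%:R.
Proof.
have tv z z' : 2^-1 * \sum_(a : bool) `|kern a z - kern a z'| =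
    `|hazard z - hazard z'|.
  rewrite big_bool /= (_ : _ - (1 - _) = hazard z' - hazard z); last by ring.
  by rewrite (distrC (hazard z')); field.
have q0 : 0 <= 2 / j.+3%:R :> R by rewrite divr_ge0.
apply/eqP; rewrite eq_le; apply/andP; split.
  apply: ge_sup; first by exists `|hazard xpred0 - hazard xpred0|, xpred0, xpred0.
  move=> _ [z [z' [zz' ->]]]; rewrite tv.
  have [hz|hz] := boolP (has id (mkseq z j)).
    have e : mkseq z' j = mkseq z j.
      by apply/eq_in_map => i; rewrite mem_iota => /zz' ->.
    have : kern true z = kern true z'.
      by rewrite (kern_mkseq true hz) -e (@kern_mkseq _ _ j)// e.
    by rewrite /kern => ->; rewrite subrr normr0.
  have zN i : (i < j)%N -> ~~ z i.
    move=> ij; apply: contra hz => zi; apply/hasP; exists true => //.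
    by apply/mapP; exists i; rewrite ?mem_iota.
  have z'N i : (i < j)%N -> ~~ z' i by move=> ij; rewrite -zz' ?zN.
  move: (hazard_bounds zN) (hazard_bounds z'N).
  move: (2 / _) => c /andP[? ?] /andP[? ?].
  by rewrite ler_norml; apply/andP; split; lra.
apply: ub_le_sup.
  exists 1 => _ [z [z' [_ ->]]]; rewrite tv ler_norml.
  have /andP[? ?] := hazard_le z; have /andP[? ?] := hazard_le z'.
  by apply/andP; split; lra.
(* The supremum is attained: a single [true] just beyond the common symbols, against no [true] at
   all. *)
exists (pred1 j), xpred0; split; first by move=> i ij; rewrite /= ltn_eqF.
rewrite tv (@hazard_first _ j) /= ?eqxx//; last by move=> i ij; rewrite ltn_eqF.
by rewrite hazard_none// subr0 ger0_norm.
Qed.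

Lemma sum_Var_kern : (\sum_(1 <= j <oo) (Var kern j)%:E = +oo)%E.
Proof.
have Var0 j : (1 <= j)%N -> true -> (0 <= (Var kern j)%:E)%E.
  by move=> _ _; rewrite lee_fin Var_kern divr_ge0.
apply/eqP; rewrite -leye_eq leNgt; apply/negP => Soo.
have S0 := nneseries_ge0 Var0.
set S := limn _ in Soo S0.
have Sr : S = (fine S)%:E by rewrite fineK// ge0_fin_numE.
apply: (@dvg_harmonic R); apply: nondecreasing_is_cvgn.
  by apply/nondecreasing_series => n _ _; exact: harmonic_ge0.
(* A finite sum would bound the harmonic series: its first term is 1, and 1/(k+2) <= 2 * 2/(k+4) for
   the others. *)
exists (1 + 2 * fine S) => _ [n _ <-].
have : ((\sum_(1 <= j < n.+1) Var kern j)%:E <= S)%E.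
  by rewrite -sumEFin; apply: nneseries_lim_ge => j ? ?; exact: Var0.
rewrite Sr lee_fin => VS.
rewrite /series /= (@le_trans _ _ (\sum_(0 <= k < n.+1) harmonic k))//.
  by rewrite big_nat_recr//= lerDl harmonic_ge0.
rewrite big_nat_recl// lerD//; first by rewrite /harmonic /= invr1.
rewrite (le_trans _ (ler_wpM2l _ VS))// mulr_sumr big_add1 /=.
apply: ler_sum => k _; rewrite Var_kern /harmonic /=.
have k0 : k%:R >= 0 :> R by [].
by rewrite mulrA ler_pdivlMr// mulrC ler_pdivrMr// !mulrS; lra.
Qed.

Lemma sum_Var_kern_powR (eps : R) : 0 < eps ->
  (\sum_(1 <= j <oo) (Var kern j `^ (1 + eps))%:E < +oo)%E.
Proof.
move=> eps0; pose c : R := 2 `^ (1 + eps) / eps.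
have c0 : 0 <= c by rewrite divr_ge0 ?powR_ge0// ltW.
(* Discrete integral comparison: eps x^(-1-eps) <= (x-1)^(-eps) - x^(-eps) for x = j+3, so the
   series is dominated by a telescoping one. *)
pose a (j : nat) : R := c * j.+2%:R `^ (- eps).
have le_a j : Var kern j `^ (1 + eps) <= a j - a j.+1.
  rewrite Var_kern /a -mulrBr; set x : R := j.+3%:R.
  have x1 : 1 < x by rewrite ltr1n.
  have jx : j.+2%:R = x - 1 by rewrite /x !mulrS; ring.
  have x0 : 0 < x by lra.
  rewrite powRM ?invr_ge0 ?(ltW x0)// /c -mulrA ler_wpM2l ?powR_ge0//.
  rewrite ler_pdivlMl// jx -powR_inv1 ?(ltW x0)// -powRrM mulN1r opprD.
  rewrite powRD; last by rewrite (gt_eqF x0) implybT.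
  rewrite powR_inv1 ?(ltW x0)// lerBrDr.
  (* Together with exp y >= 1 + y this yields (1 - 1/x)^(-eps) >= 1 + eps/x, the comparison divided
     by x^(-eps). *)
  have lx : ln (1 - x^-1) <= - x^-1.
    apply: le_ln1Dx.
    by rewrite ltrN2 invf_lt1.
  have -> : x - 1 = x * (1 - x^-1) by field; lra.
  have y0 : 0 < 1 - x^-1 by rewrite subr_gt0 invf_lt1.
  rewrite powRM ?(ltW x0) ?(ltW y0)// mulrA -[X in _ + X <= _]mul1r -mulrDl.
  rewrite mulrC ler_wpM2l ?powR_ge0// [X in _ <= X]/powR gt_eqF//.
  apply: (le_trans _ (expR_ge1Dx _)); rewrite addrC lerD2l.
  by rewrite mulNr -mulrN ler_pM2l// lerNr.
have sumle n : \sum_(1 <= j < n) Var kern j `^ (1 + eps) <= a 1%N.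
  apply: le_trans (ler_sum _ (fun j _ => le_a j)) _.
  have [n1|n1] := leqP n 1; first by rewrite big_geq// mulr_ge0 ?powR_ge0.
  under eq_bigr do rewrite -opprB; rewrite sumrN telescope_sumr ?(ltnW n1)//.
  by rewrite opprB gerBl mulr_ge0 ?powR_ge0.
apply: (@le_lt_trans _ _ (a 1%N)%:E); last exact: ltry.
apply: lime_le; first by apply: is_cvg_nneseries => j _ _; rewrite lee_fin powR_ge0.
by apply: nearW => n; rewrite sumEFin lee_fin.
Qed.

End kernel.

(** * Compatibility *)

Section density.
Context d (T : measurableType d) (R : realType).
Variables (mu : {measure set T -> \bar R}) (h : T -> \bar R).

Definition density (mh : measurable_fun setT h) (h0 : forall x, (0 <= h x)%E)
  (E : set T) : \bar R := (\int[mu]_(x in E) h x)%E.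

Hypotheses (mh : measurable_fun setT h) (h0 : forall x, (0 <= h x)%E).

Let density0 : density mh h0 set0 = 0%E.
Proof. exact: integral_set0. Qed.

Let density_ge0 E : (0 <= density mh h0 E)%E.
Proof. by apply: integral_ge0 => x _. Qed.

Let density_sigma_additive : semi_sigma_additive (density mh h0).
Proof.
move=> F mF tF mUF; rewrite /density ge0_integral_bigcup//; last first.
  exact: measurable_funTS.
by apply: is_cvg_nneseries => n _ _; exact: density_ge0.
Qed.

HB.instance Definition _ := isMeasure.Build _ _ _ (density mh h0)
  density0 density_ge0 density_sigma_additive.

End density.

Section compatibility.
Variable R : realType.

Lemma cyl_past n v : (past_cylinders n).-sigma.-measurable (cyl n v).
Proof.
elim/last_ind: v => [|v b IH].
  by rewrite cyl_nil; exact: (@measurableT _ (g_sigma_algebraType _)).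
rewrite cyl_rcons; apply: (@measurableI _ (g_sigma_algebraType _)) => //.
by apply: sub_sigma_algebra; exists (n - (size v).+1%:Z), b; split => //; lia.
Qed.

Lemma cyl_nseq n k w :
  cyl n (nseq k false) w <-> forall i, (i < k)%N -> ~~ past_before n w i.
Proof.
rewrite /cyl /= size_nseq; split=> [e i ik|wN].
  by have := congr1 (nth true ^~ i) e; rewrite nth_mkseq// nth_nseq ik => ->.
apply: (@eq_from_nth _ false); rewrite size_mkseq ?size_nseq// => i ik.
by rewrite nth_mkseq// nth_nseq ik; apply/negbTE/wN.
Qed.

Lemma cyl_nseq_rcons n k w : cyl n (rcons (nseq k false) true) w <->
  past_before n w k /\ forall i, (i < k)%N -> ~~ past_before n w i.
Proof.
by rewrite cyl_rcons size_nseq; split=> [[/cyl_nseq]|[? /cyl_nseq]].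
Qed.

(** The hazard takes countably many values: 2/(k+3) on the cylinder where the last [true] is
    preceded by exactly k more recent [false], and 0 on the intersection of the cylinders of
    [false]. *)
Lemma measurable_hazard n :
  measurable_fun [set: g_sigma_algebraType (past_cylinders n)]
    (fun w => hazard R (past_before n w)).
Proof.
move=> _ B _; rewrite setTI.
rewrite (_ : _ @^-1` _ =
  (\bigcup_k if 2 / k.+3%:R \in B then cyl n (rcons (nseq k false) true) else set0)
  `|` (if 0 \in B then \bigcap_k cyl n (nseq k false) else set0)); last first.
  apply/seteqP; split=> w /=.
    have [[k wk]|wN] := pselect (exists k, past_before n w k); last first.
      have wN' k : ~~ past_before n w k by apply/negP => wk; apply: wN; exists k.
      rewrite hazard_none// => B0; right; rewrite mem_set// => k _.
      by apply/cyl_nseq => i _.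
    pose m := find id (mkseq (past_before n w) k.+1).
    have hm : has id (mkseq (past_before n w) k.+1).
      by apply/hasP; exists true => //; apply/mapP; exists k; rewrite ?mem_iota/=.
    have mk : (m < k.+1)%N.
      by rewrite -[X in (_ < X)%N](size_mkseq (past_before n w)) -has_find.
    have wm : past_before n w m.
      by have := nth_find false hm; rewrite nth_mkseq.
    have wN i : (i < m)%N -> ~~ past_before n w i.
      move=> im; have := before_find false im.
      by rewrite nth_mkseq ?(ltn_trans im)// => ->.
    rewrite (hazard_first R wm wN) => Bm; left; exists m => //.
    by rewrite mem_set//; apply/cyl_nseq_rcons.
  case=> [[k _]|]; case: ifP => //; rewrite inE => Bx.
    by case/cyl_nseq_rcons => wk wN; rewrite (hazard_first R wk wN).
  move=> wN; rewrite hazard_none// => k.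
  by have /cyl_nseq := wN k.+1 Logic.I; apply.
apply: (@measurableU _ (g_sigma_algebraType _)).
  by apply: bigcup_measurable => k _; case: ifP => _ //; exact: cyl_past.
case: ifP => _; last exact: (@measurable0 _ (g_sigma_algebraType _)).
by apply: bigcapT_measurable => k; exact: cyl_past.
Qed.

Lemma measurable_kern_past n a :
  measurable_fun [set: g_sigma_algebraType (past_cylinders n)]
    (fun w => kern R a (past_before n w)).
Proof.
case: a => /=; first exact: measurable_hazard.
by apply: measurable_funB => //; exact: measurable_hazard.
Qed.

Lemma past_measurable n : <<s past_cylinders n >> `<=` (@measurable _ conf).
Proof.
apply: smallest_sub; first exact: sigma_algebra_measurable.
by move=> _ [i [a [_ ->]]]; exact: measurable_cyl1.
Qed.

Lemma measurable_kern n a :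
  measurable_fun [set: conf] (fun w => kern R a (past_before n w)).
Proof.
move=> _ B mB; rewrite setTI; apply: (@past_measurable n).
by rewrite -[X in <<s _ >> X]setTI; exact: measurable_kern_past.
Qed.

Definition renewal : probability conf R := stationary_law (weight R).

Lemma renewal_cyl n v : renewal (cyl n v) = (weight R v)%:E.
Proof.
apply: stationary_law_cyl => //; first exact: weight_ge0.
  exact: weight_cons.
exact: weight_rcons.
Qed.

Lemma renewal_shift : shift_invariant renewal.
Proof.
apply: stationary_law_shift => //; first exact: weight_ge0.
  exact: weight_cons.
exact: weight_rcons.
Qed.

Lemma renewal_cyl_cons n v a :
  renewal (cyl n v `&` [set w | w n = a]) = (weight R (a :: v))%:E.
Proof. by rewrite -cyl_cons; exact: renewal_cyl. Qed.

End compatibility.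

Section compatible.
Variable R : realType.

Let h n a (w : conf) : R := kern R a (past_before n w).

Let mh n a : measurable_fun [set: conf] (EFin \o h n a).
Proof. by apply/measurable_EFinP; exact: measurable_kern. Qed.

Let h0 n a w : (0 <= (EFin \o h n a) w)%E.
Proof. by rewrite lee_fin; have /andP[] := kern_bounds R a (past_before n w). Qed.

Let mA n a : measurable ([set w | w n = a] : set conf) := measurable_cyl1 n a.

(** Compatibility at site [n] for the symbol [a] amounts to the equality of [nu1] and [nu2] on the
    sigma-algebra of the past. *)
Let nu1 n a := density (renewal R) (@mh n a) (@h0 n a).
Let nu2 n a := mrestr (renewal R) (@mA n a).

Let nu1_le n a E : measurable E -> (nu1 n a E <= renewal R E)%E.
Proof.
move=> mE; rewrite -[leRHS]mul1e -integral_cst//.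
apply: ge0_le_integral => //.
- by apply: measurable_funTS; exact: mh.
- by move=> w _; rewrite lee_fin; have /andP[] := kern_bounds R a (past_before n w).
Qed.

Let nu2_le n a E : measurable E -> (nu2 n a E <= renewal R E)%E.
Proof.
move=> mE; have mEA := measurableI _ _ mE (@mA n a).
by apply: le_measure; rewrite ?inE//; exact: subIsetl.
Qed.

(** Once a [true] is visible in [v], the kernel is constant on the cylinder and equals the rate
    defining [weight]. *)
Let nu_has n a v : has id v -> nu1 n a (cyl n v) = nu2 n a (cyl n v).
Proof.
move=> hv; rewrite /nu2 /mrestr renewal_cyl_cons /=.
rewrite /nu1 /density (eq_integral (cst (rate R a v)%:E)); last first.
  move=> w /[!inE] wv; rewrite /= /h; congr EFin.
  by rewrite -[in RHS]wv; apply: kern_mkseq; rewrite wv.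
rewrite integral_cst; last exact: measurable_cyl.
transitivity ((rate R a v)%:E * (weight R v)%:E)%E; last by rewrite -EFinM mulrC.
by congr (_ * _)%E; exact: renewal_cyl.
Qed.

(* Refining a word of [false] into the past changes both sides by the same
   amount, since they agree on words containing [true]; and both are bounded by
   the probability of the word, which vanishes in the limit. *)
Let nu_nseq n a m :
  nu1 n a (cyl n (nseq m false)) = nu2 n a (cyl n (nseq m false)).
Proof.
have approx (nu : {measure set conf -> \bar R}) :
    (forall E, measurable E -> (nu E <= renewal R E)%E) ->
    exists r : nat -> R, [/\ forall k, nu (cyl n (nseq k false)) = (r k)%:E,
      forall k, 0 <= r k <= k.+1%:R^-1 &
      forall k, r k - r k.+1 = fine (nu (cyl n (rcons (nseq k false) true)))].
  move=> nu_le; have fin v : nu (cyl n v) \is a fin_num.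
    rewrite ge0_fin_numE// (le_lt_trans (nu_le _ (measurable_cyl _ _)))//.
    by rewrite renewal_cyl ltry.
  exists (fun k => fine (nu (cyl n (nseq k false)))); split=> k.
  - by rewrite fineK.
  - rewrite fine_ge0//= -lee_fin fineK// -weight_nseq -(renewal_cyl R n).
    by apply: nu_le; exact: measurable_cyl.
  - rewrite (measure_split nu (n - k.+1%:Z) (measurable_cyl n (nseq k false))).
    rewrite -{2 4}(size_nseq k false) -!cyl_rcons rcons_nseq fineD//.
    by rewrite addrK.
have [r1 [e1 b1 s1]] := approx (nu1 n a) (@nu1_le n a).
have [r2 [e2 b2 s2]] := approx (nu2 n a) (@nu2_le n a).
have dS k : r1 k - r2 k = r1 k.+1 - r2 k.+1.
  suff : r1 k - r1 k.+1 = r2 k - r2 k.+1 by lra.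
  rewrite s1 s2; congr fine; apply: nu_has.
  by rewrite has_rcons.
have dm k : r1 m - r2 m = r1 (m + k)%N - r2 (m + k)%N.
  by elim: k => [|k ->]; rewrite ?addn0// addnS -dS.
have dle k : `|r1 k - r2 k| <= k.+1%:R^-1.
  move: (b1 k) (b2 k); move: (_^-1) => c /andP[? ?] /andP[? ?].
  by rewrite ler_norml; apply/andP; split; lra.
have d0 : r1 m - r2 m = 0.
  apply/eqP; rewrite -normr_eq0 eq_le normr_ge0 andbT leNgt; apply/negP => d_gt0.
  have [k] := ltr_add_invr d_gt0; rewrite add0r ltNge => /negP; apply.
  rewrite (dm k) (le_trans (dle _))// lef_pV2 ?posrE// ler_nat.
  by rewrite ltnS leq_addl.
transitivity (r1 m)%:E; first exact: e1.
by rewrite (subr0_eq d0); symmetry; exact: e2.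
Qed.

Lemma compatible_renewal : compatible (renewal R) (kern R).
Proof.
move=> n a; exists (h n a); last by apply: aeW.
split; first exact: measurable_kern_past.
- apply: (@le_integrable _ _ _ _ _ _ _ (EFin \o cst 1)) => //.
    move=> w _; rewrite /= lee_fin normr1.
    by have /andP[? ?] := kern_bounds R a (past_before n w); rewrite ger0_norm.
  exact: finite_measure_integrable_cst.
move=> E nE; apply: (@eq_measure_past _ (nu1 n a) (nu2 n a) _ n) => // [|v].
  by rewrite (le_lt_trans (nu1_le n a measurableT))// probability_setT ltry.
have [hv|/seq_false ->] := boolP (has id v); first exact: nu_has.
exact: nu_nseq.
Qed.

End compatible.

(** * Failure of the Gaussian concentration bound *)

Lemma expR_not_linear (R : realType) (y : R) : 0 < y ->
  exists n : nat, n.+2%:R < expR (y * n.+1%:R).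
Proof.
(* With y^2 N > 8 one has (yN/2)^2 >= 2N, hence exp(yN) >= (1 + yN/2)^2 > N + 1. *)
move=> y0; pose N := (Num.truncn (8 / y ^+ 2)).+1.
have N8 : 8 < y ^+ 2 * N%:R.
  by rewrite mulrC -ltr_pdivrMr ?exprn_gt0// truncnS_gt.
exists N.-1; rewrite prednK//; have N1 : 1 <= N%:R :> R by rewrite ler1n.
have e1 : 1 + y * N%:R / 2 <= expR (y * N%:R / 2) by exact: expR_ge1Dx.
have yN : 0 <= y * N%:R / 2 by rewrite divr_ge0// mulr_ge0// ltW.
have e2 : (1 + y * N%:R / 2) ^+ 2 <= expR (y * N%:R).
  have -> : y * N%:R = y * N%:R / 2 + y * N%:R / 2 by field.
  by rewrite expRD -expr2 ler_sqr ?nnegrE ?expR_ge0//; lra.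
apply: lt_le_trans e2; rewrite /N mulrS -/N.
have : 2 * N%:R <= (y * N%:R / 2) ^+ 2 by nra.
by nra.
Qed.

Section zeros.
Variables (R : realType) (lam : R) (n : nat).
Hypothesis lam_ge0 : 0 <= lam.

Definition zeros (x : {ffun 'I_n.+1 -> bool}) : R :=
  \sum_(j < n.+1) lam * (~~ x j)%:R.

(** Changing one symbol changes the count by at most one. The lower bound excludes the value -oo, so
    that [fine] can be squared safely. *)
Lemma delta_zeros j : (0 <= delta zeros j <= lam%:E)%E.
Proof.
apply/andP; split.
  apply: ereal_sup_ubound; exists true, true, [ffun=> true].
  by rewrite subrr normr0.
apply: ge_ereal_sup => _ [a [b [w ->]]]; rewrite lee_fin /zeros -sumrB.
rewrite (bigD1 j)//= big1 ?addr0 => [|i ij]; last first.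
  by rewrite !ffunE (negbTE ij) subrr.
rewrite !ffunE eqxx -mulrBr normrM ger0_norm// ler_piMr//.
by case: a; case: b; rewrite ?subrr ?normr0 ?subr0 ?sub0r ?normrN ?normr1.
Qed.

Lemma in_L_zeros : in_L zeros.
Proof.
by move=> j; have /andP[_ /le_lt_trans] := delta_zeros j; apply; exact: ltry.
Qed.

Lemma delta_norm2_sq_zeros : delta_norm2_sq zeros <= n.+1%:R * lam ^+ 2.
Proof.
rewrite mulr_natl -[X in _ *+ X]card_ord -sumr_const.
apply: ler_sum => j _; have := delta_zeros j.
by case: (delta zeros j) => [r| |]//= /andP[? ?]; rewrite lerXn2r.
Qed.

Lemma on_conf_zeros w :
  on_conf zeros w = \sum_(j < n.+1) lam * \1_[set w : conf | w j%:Z = false] w.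
Proof.
apply: eq_bigr => j _; rewrite ffunE indicE; congr (_ * (nat_of_bool _)%:R).
by apply/idP/idP; rewrite inE /=; case: (w _).
Qed.

Lemma measurable_zeros : measurable_fun setT (on_conf zeros).
Proof.
rewrite (_ : on_conf zeros = fun w =>
    \sum_(j < n.+1) lam * \1_[set w : conf | w j%:Z = false] w); last first.
  by apply/funext => w; exact: on_conf_zeros.
apply: measurable_sum => j; apply: measurable_funM => //.
by apply: measurable_indic; exact: measurable_cyl1.
Qed.

Lemma expectation_zeros :
  ('E_(renewal R)[on_conf zeros] = (n.+1%:R * lam / 2)%:E)%E.
Proof.
rewrite unlock; under eq_integral do rewrite on_conf_zeros -sumEFin.
rewrite ge0_integral_sum//; last 2 first.
- move=> j; apply/measurable_EFinP; apply: measurable_funM => //.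
  by apply: measurable_indic; exact: measurable_cyl1.
- by move=> j w _; rewrite lee_fin mulr_ge0.
have E j : (\int[renewal R]_w (lam * \1_[set w : conf | w j%:Z = false] w)%:E =
    (lam / 2)%:E)%E.
  under eq_integral do rewrite EFinM.
  rewrite ge0_integralZl//; last first.
    by apply/measurable_EFinP/measurable_indic; exact: measurable_cyl1.
  rewrite integral_indic//; last exact: measurable_cyl1.
  rewrite EFinM setIC -(cyl_nil j%:Z); congr (_ * _)%E.
  transitivity (weight R [:: false])%:E; first exact: renewal_cyl_cons.
  by rewrite /= /rate /=; congr EFin; field.
under eq_bigr do rewrite E.
by rewrite sumEFin sumr_const card_ord -[in RHS]mulrA mulr_natl.
Qed.

End zeros.

Lemma renewal_not_GCB (R : realType) : ~ GCB (renewal R).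
Proof.
(* This value maximizes lam/2 - C lam^2, the gain per symbol in the exponent; the maximum is
   lam/4. *)
move=> [C [C0 H]]; pose lam := (4 * C)^-1.
have lam0 : 0 < lam by rewrite invr_gt0 mulr_gt0.
have [n] : exists n : nat, n.+2%:R < expR (lam / 4 * n.+1%:R).
  by apply: expR_not_linear; rewrite divr_gt0.
apply/negP; rewrite -leNgt.
have := H n _ (in_L_zeros (ltW lam0)).
rewrite (expectation_zeros n (ltW lam0)) /= => GC.
pose f := @zeros R lam n.
have mf : measurable_fun [set: conf]
    (fun w => expR (on_conf f w - n.+1%:R * lam / 2)).
  apply: measurableT_comp => //; apply: measurable_funB => //.
  exact: measurable_zeros.
(* The expectation is restricted to the event of n+1 symbols [false], of probability 1/(n+2), where
   the function exceeds its mean by (n+1) lam/2. *)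
have lb : ((expR (n.+1%:R * lam / 2) * n.+2%:R^-1)%:E <=
    'E_(renewal R)[fun w => expR (on_conf f w - n.+1%:R * lam / 2)])%E.
  rewrite unlock.
  apply: (@le_trans _ _ (\int[renewal R]_(w in cyl n.+1%:Z (nseq n.+1 false))
      (expR (on_conf f w - n.+1%:R * lam / 2))%:E)%E); last first.
    apply: ge0_subset_integral => //; first exact: measurable_cyl.
    exact/measurable_EFinP.
  rewrite (eq_integral (cst (expR (n.+1%:R * lam / 2))%:E)); last first.
    move=> w /[!inE] /cyl_nseq wN; congr (expR _)%:E.
    suff -> : on_conf f w = n.+1%:R * lam by field.
    rewrite /on_conf /f /zeros (eq_bigr (fun=> lam)) => [|j _].
      by rewrite sumr_const card_ord mulr_natl.
    (* Seen from site n+1, the past index of site j is n-j. *)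
    rewrite ffunE; have := wN (n - j)%N; rewrite ltnS leq_subr => /(_ isT).
    rewrite /past_before (_ : _ - _ = j%:Z); first by move=> ->; rewrite mulr1.
    by have := ltn_ord j; lia.
  rewrite integral_cst; last exact: measurable_cyl.
  rewrite EFinM; apply: lee_pmul => //; rewrite ?lee_fin ?expR_ge0//.
  by rewrite -(weight_nseq R n.+1) -(renewal_cyl R n.+1%:Z).
have := le_trans lb GC; rewrite lee_fin => le1.
have {le1}: expR (n.+1%:R * lam / 2) * n.+2%:R^-1 <=
    expR (C * (n.+1%:R * lam ^+ 2)).
  apply: (le_trans le1); rewrite ler_expR ler_wpM2l ?(ltW C0)//.
  exact/delta_norm2_sq_zeros/ltW.
rewrite ler_pdivrMr// -ler_pdivrMl ?expR_gt0// -expRN -expRD.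
apply: le_trans; rewrite ler_expR /lam.
by rewrite le_eqVlt; apply/orP; left; apply/eqP; field; lra.
Qed.

Theorem corollary3p2 (R : realType) (eps : R) (heps : 0 < eps) :
  exists (g : bool -> past -> R) (mu : probability conf R),
    [/\ is_kernel g, shift_invariant mu & compatible mu g] /\
    [/\ (\sum_(1 <= j <oo) (Var g j `^ (1 + eps))%:E < +oo)%E,
        (\sum_(1 <= j <oo) (Var g j)%:E = +oo)%E,
        ~ GCB mu
      & exists a : bool, 0 < inf [set g a x | x in [set: past]]].
Proof.
exists (kern R), (renewal R); split; split.
- exact: is_kernel_kern.
- exact: renewal_shift.
- exact: compatible_renewal.
- exact: sum_Var_kern_powR.
- exact: sum_Var_kern.
- exact: renewal_not_GCB.
- by exists false; exact: inf_kern_false.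
Qed.
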